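(* Let $X$ be a concrete cubeset. Then the following assertions are equivalent. (a) The cubeset $X$ is fibrant. (b) The projection $j^*X\to *$ has the right lifting property against $\Lambda_\Gamma$, i.e. the underlying $\Gamma$-set of $X$ is fibrant with respect to $\Lambda_\Gamma$.
   Context: The cube category $\Box$ has objects $\{0,1\}^n$ ($n\in\mathbb N_0$) and morphisms the maps $\{0,1\}^n\to\{0,1\}^m$ that are restrictions of affine linear maps $\mathbb Z^n\to\mathbb Z^m$. Its wide subcategory of restrictions of linear maps is identified with Segal's category $\Gamma$ (opposite of finite pointed sets); $j\colon\Gamma\to\Box$ is the inclusion. A cubeset is a presheaf of sets on $\Box$, a $\Gamma$-set is a presheaf of sets on $\Gamma$; $j^*$ denotes restriction of presheaves along $j$. $\Box^n$ and $\Gamma^n$ denote the presheaves on $\Box$, resp. $\Gamma$, represented by $\{0,1\}^n$; $X(n)$ is the value of a presheaf on $\{0,1\}^n$. A cubeset $X$ is concrete if for all $n$ the vertex map $X(n)\to X(0)^{\{0,1\}^n}$ is injective. For $n\ge1$ the corner $\Lambda^n\subseteq\Box^n$ is the union of the images of the maps $\varepsilon_i\colon\Box^{n-1}\to\Box^n$, $1\le i\le n$, inserting a $0$ at coordinate $i$. $X$ is fibrant if every map $\Lambda^n\to X$ extends along $\Lambda^n\to\Box^n$, for all $n\ge1$. For $n\ge1$ and $\omega\in\{0,1\}^n\setminus\{0^n\}$, the corner $\Lambda^n_\omega\subseteq\Gamma^n$ is the union (of sub-presheaves of $\Gamma^n$) of the images of all injective linear maps $f\colon\{0,1\}^{n-1}\to\{0,1\}^n$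 in $\Gamma$ such that $\omega\notin\mathrm{im} f$. Set $\Lambda_\Gamma=\{\Lambda^n_\omega\hookrightarrow\Gamma^n\mid n\ge1,\ \omega\in\{0,1\}^n\setminus\{0^n\}\}$. *)

(* Defs.v *)
From mathcomp Require Import all_boot all_order all_algebra.
From mathcomp Require Import boolp.
Set Implicit Arguments.
Unset Strict Implicit.
Unset Printing Implicit Defensive.
Import GRing.Theory.
Local Open Scope ring_scope.

Record category := Category {
  obj : Type;
  hom : obj -> obj -> Type;
  idm : forall a, hom a a;
  compm : forall a b c, hom b c -> hom a b -> hom a c;
  compm_idl : forall a b (f : hom a b), compm (idm b) f = f;
  compm_idr : forall a b (f : hom a b), compm f (idm a) = f;
  compmA : forall a b c d (h : hom c d) (g : hom b c) (f : hom a b),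
    compm h (compm g f) = compm (compm h g) f
}.
Arguments idm {c0} a : rename.

Record functor (C D : category) := Functor {
  fun_obj :> obj C -> obj D;
  fun_hom : forall a b, hom a b -> hom (fun_obj a) (fun_obj b);
  fun_id : forall a, fun_hom (idm a) = idm (fun_obj a);
  fun_comp : forall a b c (g : hom b c) (f : hom a b),
    fun_hom (compm g f) = compm (fun_hom g) (fun_hom f)
}.

Record presheaf (C : category) := Presheaf {
  val_at :> obj C -> Type;
  res : forall a b, hom a b -> val_at b -> val_at a;
  res_id : forall a (x : val_at a), res (idm a) x = x;
  res_comp : forall a b c (g : hom b c) (f : hom a b) (x : val_at c),
    res (compm g f) x = res f (res g x)
}.

Record nattrans (C : category) (X Y : presheaf C) := NatTrans {
  nt_app :> forall a, X a -> Y a;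
  nt_natural : forall a b (f : hom a b) (x : X b),
    nt_app (res f x) = res f (nt_app x)
}.
Arguments nt_app {C X Y} _ a _.

Definition terminal (C : category) : presheaf C :=
  @Presheaf C (fun _ => unit) (fun _ _ _ x => x)
    (fun _ _ => erefl) (fun _ _ _ _ _ _ => erefl).

Definition to_terminal (C : category) (X : presheaf C) :
    nattrans X (terminal C) :=
  @NatTrans C X (terminal C) (fun _ _ => tt) (fun _ _ _ _ => erefl).

Definition restriction (C D : category) (F : functor C D) (X : presheaf D) :
  presheaf C.
Proof.
refine (@Presheaf C (fun a => X (F a)) (fun a b f => res (fun_hom F f)) _ _).
- by move=> a x; rewrite fun_id res_id.
- by move=> a b c g f x; rewrite fun_comp res_comp.
Defined.

Definition yoneda (C : category) (a : obj C) : presheaf C :=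
  @Presheaf C (fun k => hom k a) (fun _ _ f g => compm g f)
    (fun _ g => compm_idr g) (fun _ _ _ g f h => compmA h g f).

Definition yoneda_map (C : category) (a b : obj C) (f : hom a b) :
    nattrans (yoneda a) (yoneda b) :=
  @NatTrans C (yoneda a) (yoneda b) (fun k g => compm f g)
    (fun _ _ h g => compmA f g h).

Record subpresheaf (C : category) (X : presheaf C) := SubPresheaf {
  mem_at :> forall a, X a -> Prop;
  mem_res : forall a b (f : hom a b) (x : X b), mem_at x -> mem_at (res f x)
}.
Arguments mem_at {C X} _ a _.

Definition sub_val (C : category) (X : presheaf C) (S : subpresheaf X) :
  presheaf C.
Proof.
refine (@Presheaf C (fun a => {x : X a | S a x})
  (fun a b f x => exist _ (res f (proj1_sig x))
                          (mem_res f (proj2_sig x))) _ _).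
- by move=> a [x Sx]; apply: eq_exist; rewrite /= res_id.
- by move=> a b c g f [x Sx]; apply: eq_exist; rewrite /= res_comp.
Defined.

Definition inclusion (C : category) (X : presheaf C) (S : subpresheaf X) :
    nattrans (sub_val S) X :=
  @NatTrans C (sub_val S) X (fun _ x => proj1_sig x) (fun _ _ _ _ => erefl).

Definition sub_image (C : category) (X Y : presheaf C) (p : nattrans X Y) :
  subpresheaf Y.
Proof.
refine (@SubPresheaf C Y (fun a y => exists x : X a, p a x = y) _).
by move=> a b f _ [x <-]; exists (res f x); rewrite nt_natural.
Defined.

Definition sub_union (C : category) (X : presheaf C) (I : Type) (P : I -> Prop)
    (S : I -> subpresheaf X) : subpresheaf X.
Proof.
refine (@SubPresheaf C X (fun a x => exists2 i, P i & S i a x) _).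
by move=> a b f x [i Pi Sx]; exists i => //; apply: mem_res.
Defined.

(* Equalities of natural transformations are stated componentwise. *)
Definition has_rlp (C : category) (Y Z A B : presheaf C) (p : nattrans Y Z)
    (i : nattrans A B) : Prop :=
  forall (u : nattrans A Y) (v : nattrans B Z),
    (forall a x, p a (u a x) = v a (i a x)) ->
    exists h : nattrans B Y,
      (forall a x, h a (i a x) = u a x) /\ (forall a y, p a (h a y) = v a y).

Definition has_rlp_against (C : category) (Y Z : presheaf C)
    (p : nattrans Y Z)
    (L : forall A B : presheaf C, nattrans A B -> Prop) : Prop :=
  forall (A B : presheaf C) (i : nattrans A B), L A B i -> has_rlp p i.

Definition cube (n : nat) := {ffun 'I_n -> bool}.

Definition vertex0 (n : nat) : cube n := [ffun=> false].

(* The inclusion of {0,1}^n into Z^n, with vectors written as rows. *)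
Definition cube_vec (n : nat) (x : cube n) : 'rV[int]_n := \row_i (x i)%:R.

Definition is_affine (m n : nat) (f : cube m -> cube n) : Prop :=
  exists (A : 'M[int]_(m, n)) (b : 'rV[int]_n),
    forall x, cube_vec (f x) = cube_vec x *m A + b.

Definition is_linear (m n : nat) (f : cube m -> cube n) : Prop :=
  exists A : 'M[int]_(m, n), forall x, cube_vec (f x) = cube_vec x *m A.

Record box_hom (m n : nat) := BoxHom {
  box_fun :> cube m -> cube n;
  box_affine : is_affine box_fun
}.

Record gamma_hom (m n : nat) := GammaHom {
  gamma_fun :> cube m -> cube n;
  gamma_linear : is_linear gamma_fun
}.

Lemma box_hom_eq (m n : nat) (f g : box_hom m n) : f =1 g -> f = g.
Proof.
case: f g => [f Hf] [g Hg] /= /funext fg; rewrite -{}fg in Hg *.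
by rewrite (Prop_irrelevance Hf Hg).
Qed.

Lemma gamma_hom_eq (m n : nat) (f g : gamma_hom m n) : f =1 g -> f = g.
Proof.
case: f g => [f Hf] [g Hg] /= /funext fg; rewrite -{}fg in Hg *.
by rewrite (Prop_irrelevance Hf Hg).
Qed.

Lemma is_linear_id (n : nat) : is_linear (@id (cube n)).
Proof. by exists 1%:M => x; rewrite mulmx1. Qed.

Lemma is_linear_comp (m n p : nat) (g : cube n -> cube p)
    (f : cube m -> cube n) :
  is_linear g -> is_linear f -> is_linear (g \o f).
Proof. by case=> B gE [A fE]; exists (A *m B) => x /=; rewrite gE fE mulmxA. Qed.

Lemma is_linear_affine (m n : nat) (f : cube m -> cube n) :
  is_linear f -> is_affine f.
Proof. by case=> A fE; exists A, 0 => x; rewrite addr0. Qed.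

Lemma is_affine_comp (m n p : nat) (g : cube n -> cube p)
    (f : cube m -> cube n) :
  is_affine g -> is_affine f -> is_affine (g \o f).
Proof.
case=> B [c gE] [A [b fE]]; exists (A *m B), (b *m B + c) => x /=.
by rewrite gE fE mulmxDl mulmxA addrA.
Qed.

Lemma is_affine_const (m n : nat) (v : cube n) :
  is_affine (fun _ : cube m => v).
Proof. by exists 0, (cube_vec v) => x; rewrite mulmx0 add0r. Qed.

Definition Box : category.
Proof.
refine (@Category nat box_hom
  (fun n => BoxHom (is_linear_affine (@is_linear_id n)))
  (fun m n p g f => BoxHom (is_affine_comp (box_affine g) (box_affine f)))
  _ _ _).
all: by move=> *; apply: box_hom_eq.
Defined.

Definition Gamma : category.
Proof.
refine (@Category nat gamma_hom
  (fun n => GammaHom (@is_linear_id n))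
  (fun m n p g f =>
     GammaHom (is_linear_comp (gamma_linear g) (gamma_linear f)))
  _ _ _).
all: by move=> *; apply: gamma_hom_eq.
Defined.

Definition Gamma_to_Box : functor Gamma Box.
Proof.
refine (@Functor Gamma Box (fun n => n)
  (fun m n (f : gamma_hom m n) => BoxHom (is_linear_affine (gamma_linear f)))
  _ _).
all: by move=> *; apply: box_hom_eq.
Defined.

Definition cubeset := presheaf Box.
Definition gammaset := presheaf Gamma.

Definition vertex_hom (n : nat) (v : cube n) : box_hom 0 n :=
  BoxHom (is_affine_const 0 v).

Definition vertex_map (X : cubeset) (n : nat) (x : X n) : cube n -> X 0%N :=
  fun v => @res Box X 0%N n (vertex_hom v) x.

Definition concrete (X : cubeset) : Prop :=
  forall n : nat, injective (@vertex_map X n).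

Definition insert0 (n : nat) (i : 'I_n.+1) (x : cube n) : cube n.+1 :=
  [ffun k => if unlift i k is Some l then x l else false].

Lemma is_linear_insert0 (n : nat) (i : 'I_n.+1) : is_linear (insert0 i).
Proof.
exists (\matrix_(l, k) (k == lift i l)%:R) => x.
apply/rowP => k; rewrite !mxE ffunE.
case: unliftP => [l ->|->].
  rewrite (bigD1 l) //= !mxE eqxx mulr1 big1 ?addr0 // => l' /negPf ne.
  by rewrite !mxE (inj_eq lift_inj) eq_sym ne mulr0.
by rewrite big1 // => l _; rewrite !mxE (negPf (neq_lift _ _)) mulr0.
Qed.

Definition face (n : nat) (i : 'I_n.+1) : box_hom n n.+1 :=
  BoxHom (is_linear_affine (is_linear_insert0 i)).

(* Only dimensions at least 1 carry corners: the index n stands for the corner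
   of the cube of dimension n.+1, here and in gamma_corner. *)
Definition box_corner (n : nat) : subpresheaf (@yoneda Box n.+1) :=
  sub_union (fun _ : 'I_n.+1 => True)
        (fun i => sub_image (@yoneda_map Box n n.+1 (face i))).

Definition fibrant (X : cubeset) : Prop :=
  forall (n : nat) (u : nattrans (sub_val (box_corner n)) X),
    exists h : nattrans (@yoneda Box n.+1) X,
      forall k x, h k (inclusion (box_corner n) k x) = u k x.

Definition gamma_corner (n : nat) (w : cube n.+1) :
    subpresheaf (@yoneda Gamma n.+1) :=
  sub_union (fun f : gamma_hom n n.+1 => injective f /\ w \notin codom f)
        (fun f => sub_image (@yoneda_map Gamma n n.+1 f)).

Inductive Lambda_Gamma : forall A B : gammaset, nattrans A B -> Prop :=
| Lambda_Gamma_corner (n : nat) (w : cube n.+1) :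
    w != vertex0 n.+1 -> Lambda_Gamma (inclusion (gamma_corner w)).

(* Main.v *)
Require Import Defs.
From mathcomp Require Import all_boot all_order all_algebra.
From mathcomp Require Import boolp.
Set Implicit Arguments.
Unset Strict Implicit.
Unset Printing Implicit Defensive.
Import GRing.Theory Num.Theory.
Local Open Scope ring_scope.

(** The Gamma-corner at w = 1...1 lies in the restriction of the cubical corner
    to Gamma, and it contains the faces generating the latter.  Lifting against
    this single corner therefore already gives fibrancy
    ([gamma_rlp_fibrant]).

    Conversely, let X be concrete and fibrant.  An element of X(n) is determined
    by its vertices, so X(n) can be seen as a set of [cubical] functions
    {0,1}^n -> X(0), closed under precomposition with affine maps.  A map from
    the Gamma-corner at w to X is given by a function f on {0,1}^n minus w
    ([gamma_corner_values], with an arbitrary value at w), and the restrictions of f to the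
    hyperplanes x_a = 0 with w_a = 1 and x_a = x_b with w_a <> w_b are cubical.
    After reflecting coordinates, fibrancy extends f over w as soon as f is
    cubical on every face that misses w ([corner_completion_at]).  The faces
    x_a = 0 with w_a = 1 are given; missing are the faces x_b = 1 with w_b = 0.
    Choose a with w_a = 1 and write f(s,t) for the restriction of f to x_a = s,
    x_b = t.  The face x_a = 0 is the cube [f(0,0), f(0,1)] and the diagonal
    x_a = x_b is the cube [f(0,0), f(1,1)].  In a fibrant cubeset two cubes with
    a common face can be glued along it ([face_gluing]), and the result,
    [f(0,1), f(1,1)], is the face x_b = 1.

    Gluing in turn follows from filling: a function whose restrictions to some
    of the faces x_a = 0 are cubical can be changed off these faces to become
    cubical ([corner_filling]).  The two given cubes are put on the faces
    x_a = 0 and x_b = 0, and the filler is restricted to the antidiagonal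
    x_b = 1 - x_a. *)

(** * Vertices and affine maps of cubes *)

Definition vertex1 (n : nat) : cube n := [ffun=> true].

Definition drop_coord (n : nat) (a : 'I_n.+1) (x : cube n.+1) : cube n :=
  [ffun l => x (lift a l)].

Definition fix_coord (n : nat) (a : 'I_n) (c : bool) (x : cube n) : cube n :=
  [ffun k => if k == a then c else x k].

Definition copy_coord (n : nat) (a b : 'I_n) (x : cube n) : cube n :=
  [ffun k => if k == a then x b else x k].

Lemma neq_vertex1 (n : nat) (x : cube n) :
  x != vertex1 n -> exists a, x a = false.
Proof.
case: (pickP (fun a => ~~ x a)) => [a /negbTE xa|xT]; first by exists a.
by case/eqP; apply/ffunP => a; rewrite ffunE -[x a]negbK xT.
Qed.

Lemma neq_vertex0 (n : nat) (x : cube n) :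
  x != vertex0 n -> exists a, x a.
Proof.
case: (pickP x) => [a xa|xF]; first by exists a.
by case/eqP; apply/ffunP => a; rewrite ffunE xF.
Qed.

(** A coordinate that is 0, 1, x_i or 1 - x_i is the restriction of an affine
    functional: the four cases are [o] (None for the constants) with a negation
    flag [e], and flipping x_i is the functional 1 - x_i. *)
Lemma affine_coord (m n : nat) (f : cube m -> cube n) :
  (forall k, exists (o : option 'I_m) (e : bool),
     forall x, f x k = oapp x false o (+) e) ->
  is_affine f.
Proof.
move=> fP.
have [p pP] : exists p : 'I_n -> option 'I_m * bool,
    forall k x, f x k = oapp x false (p k).1 (+) (p k).2.
  have [k|p pP] := @choice _ _ (fun k (q : option 'I_m * bool) =>
    forall x, f x k = oapp x false q.1 (+) q.2); last by exists p.
  by have [o [e fE]] := fP k; exists (o, e).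
exists (\matrix_(i, k) (((p k).1 == Some i)%:R * (-1) ^+ (p k).2)).
exists (\row_k ((p k).2)%:R) => x; apply/rowP => k; rewrite !mxE pP.
case pk: (p k) => [[i|] e] /=; last first.
  by rewrite big1 ?add0r // => i _; rewrite !mxE pk mul0r mulr0.
rewrite (bigD1 i) //= !mxE pk eqxx big1 => [|j /negPf ji]; last first.
  by rewrite !mxE pk (inj_eq Some_inj) eq_sym ji mul0r mulr0.
by case: (x i); case: {pk}e; rewrite ?mul1r ?mul0r ?expr1 ?addr0 ?add0r ?addNr.
Qed.

Lemma cube_vec_inj (n : nat) : injective (@cube_vec n).
Proof.
move=> x y /rowP xy; apply/ffunP => k; have := xy k; rewrite !mxE.
by case: (x k); case: (y k).
Qed.

Lemma cube_vec0 (n : nat) : cube_vec (vertex0 n) = 0.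
Proof. by apply/rowP => k; rewrite !mxE ffunE. Qed.

Lemma linear_vertex0 (m n : nat) (f : cube m -> cube n) :
  is_linear f -> f (vertex0 m) = vertex0 n.
Proof.
by case=> A fE; apply: cube_vec_inj; rewrite fE !cube_vec0 mul0mx.
Qed.

Lemma affine_linear (m n : nat) (f : cube m -> cube n) :
  is_affine f -> f (vertex0 m) = vertex0 n -> is_linear f.
Proof.
case=> A [b fE] f0; exists A => x; rewrite fE.
by have := fE (vertex0 m); rewrite f0 !cube_vec0 mul0mx add0r => <-;
  rewrite addr0.
Qed.

(** The coefficients of the functional x |-> (f x)_k are its values at the basis
    vectors, hence nonnegative, so it is largest at 1...1. *)
Lemma linear_coord_le (m n : nat) (f : cube m -> cube n) (k : 'I_n) :
  is_linear f -> f (vertex1 m) k = false -> forall x, f x k = false.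
Proof.
case=> A fE f1 x.
have A0 i : 0 <= A i k.
  have /rowP/(_ k) := fE [ffun l => l == i].
  rewrite !mxE (bigD1 i) //= !mxE ffunE eqxx mul1r big1 ?addr0 => [<-|j].
    by rewrite ler0n.
  by move=> /negPf ji; rewrite !mxE ffunE ji mul0r.
have /rowP/(_ k) := fE (vertex1 m); rewrite !mxE f1.
move=> /esym/eqP; rewrite psumr_eq0 => [/allP s0|i _]; last first.
  by rewrite !mxE ffunE mul1r.
have /rowP/(_ k) := fE x; rewrite !mxE big1 => [|i _]; first by case: (f x k).
have /= := s0 i (mem_index_enum _); rewrite !mxE ffunE mul1r => /eqP ->.
by rewrite mulr0.
Qed.

Lemma affine_drop (n : nat) (a : 'I_n.+1) : is_affine (drop_coord a).
Proof.
by apply: affine_coord => l; exists (Some (lift a l)), false => x;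
  rewrite ffunE addbF.
Qed.

Lemma affine_fix (n : nat) (a : 'I_n) (c : bool) : is_affine (fix_coord a c).
Proof.
apply: affine_coord => k; case ka: (k == a).
  by exists None, c => x; rewrite ffunE ka.
by exists (Some k), false => x; rewrite ffunE ka addbF.
Qed.

Lemma affine_copy (n : nat) (a b : 'I_n) : is_affine (copy_coord a b).
Proof.
apply: affine_coord => k; exists (Some (if k == a then b else k)), false => x.
by rewrite ffunE addbF /=; case: (k == a).
Qed.

Lemma affine_insert0 (n : nat) (a : 'I_n.+1) : is_affine (insert0 a).
Proof. exact/is_linear_affine/is_linear_insert0. Qed.

Lemma insert0K (n : nat) (a : 'I_n.+1) : cancel (insert0 a) (drop_coord a).
Proof. by move=> x; apply/ffunP => l; rewrite !ffunE liftK. Qed.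

Lemma drop_coordK (n : nat) (a : 'I_n.+1) (x : cube n.+1) :
  insert0 a (drop_coord a x) = fix_coord a false x.
Proof.
apply/ffunP => k; rewrite !ffunE; case: unliftP => [l ->|->];
  last by rewrite eqxx.
by rewrite eq_sym (negPf (neq_lift _ _)) ffunE.
Qed.

Lemma fix_coord_id (n : nat) (a : 'I_n) (c : bool) (x : cube n) :
  x a = c -> fix_coord a c x = x.
Proof. by move=> xa; apply/ffunP => k; rewrite !ffunE; case: eqP => [->|]. Qed.

(** * Cubes of a concrete cubeset as functions on vertices *)

Lemma vertex_map_res (X : cubeset) (m n : nat) (g : box_hom m n) (x : X n) :
  vertex_map (@res Box X m n g x) =1 vertex_map x \o g.
Proof.
move=> v; rewrite /vertex_map /= -res_comp.
by congr (res _ x); apply: box_hom_eq.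
Qed.

Lemma vertex_map0 (X : cubeset) (x : X 0%N) v : vertex_map x v = x.
Proof.
rewrite /vertex_map -[RHS]res_id; congr (res _ x); apply: box_hom_eq => t /=.
by apply/ffunP => - [].
Qed.

Lemma concrete_eq (X : cubeset) (n : nat) (x y : X n) :
  concrete X -> vertex_map x =1 vertex_map y -> x = y.
Proof. by move=> hX /funext /hX. Qed.

Definition cubical (X : cubeset) (n : nat) (f : cube n -> X 0%N) : Prop :=
  exists x : X n, vertex_map x =1 f.

Lemma cubical_eq (X : cubeset) (n : nat) (f g : cube n -> X 0%N) :
  f =1 g -> cubical f -> cubical g.
Proof. by move=> fg [x xf]; exists x => v; rewrite xf. Qed.

Lemma cubical_comp (X : cubeset) (m n : nat) (f : cube n -> X 0%N)
    (g : cube m -> cube n) :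
  is_affine g -> cubical f -> cubical (f \o g).
Proof.
move=> gA [x xf]; exists (@res Box X m n (BoxHom gA) x) => v.
by rewrite vertex_map_res /= xf.
Qed.


(** * Completion, filling and gluing in fibrant concrete cubesets *)

(** The condition that f is cubical on the face x_a = 0 is expressed by
    precomposition with the projection onto this face, which keeps the dimension
    constant.  By concreteness the cubes on the faces are unique, so they fit
    together to a map from the corner, and an extension of this map is a cube
    with the prescribed vertices. *)
Lemma corner_completion (X : cubeset) (n : nat) (f : cube n.+1 -> X 0%N) :
  concrete X -> fibrant X ->
  (forall a, cubical (f \o fix_coord a false)) ->
  exists2 g, cubical g & forall x, x != vertex1 n.+1 -> g x = f x.
Proof.
move=> hX fX fC.
have uE k (q : sub_val (box_corner n) k) :
    exists x : X k, vertex_map x =1 f \o (proj1_sig q : box_hom k n.+1).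
  case: q => /= _ [a _ [s <-]].
  apply: cubical_eq (cubical_comp (box_affine s)
                       (cubical_comp (affine_insert0 a) (fC a))) => v /=.
  by rewrite -drop_coordK insert0K.
pose u k q := proj1_sig (cid (uE k q)).
have uP k q : vertex_map (u k q) =1 f \o (proj1_sig q : box_hom k n.+1).
  exact: proj2_sig (cid (uE k q)).
have uN (a b : obj Box) (g : Defs.hom a b) (q : sub_val (box_corner n) b) :
    u a (res g q) = res g (u b q).
  by apply: concrete_eq => // v; rewrite vertex_map_res /= !uP.
have [h hE] := fX n (NatTrans uN).
exists (vertex_map (h n.+1 (@idm Box n.+1))); first by eexists.
move=> x x1; have [a xa] := neq_vertex1 x1.
have xC : box_corner n 0%N (vertex_hom x).
  exists a => //; exists (vertex_hom (drop_coord a x)).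
  by apply: box_hom_eq => v /=; rewrite drop_coordK fix_coord_id.
have := hE 0%N (exist _ _ xC); rewrite /vertex_map -nt_natural /=.
have -> : BoxHom (is_affine_comp (is_linear_affine (is_linear_id n.+1))
                    (is_affine_const 0 x)) = vertex_hom x.
  exact: box_hom_eq.
by move=> ->; rewrite -[LHS](vertex_map0 _ (vertex0 0)) uP.
Qed.

(** When S is the set of all coordinates this is completion.  Otherwise choose c
    outside S, first fill the face x_c = 0, which has smaller dimension, and
    replace f by the filler there: this does not change f on the faces indexed
    by S, and the face x_c = 0 has become cubical, so c can be added to S. *)
Lemma corner_filling (X : cubeset) (n : nat) (S : {set 'I_n})
    (f : cube n -> X 0%N) :
  concrete X -> fibrant X ->
  (forall a, a \in S -> cubical (f \o fix_coord a false)) ->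
  exists2 g, cubical g &
    forall (x : cube n) a, a \in S -> x a = false -> g x = f x.
Proof.
move=> hX fX; elim: n => [|n IHn] in S f *.
  move=> _; exists f => //; exists (f (vertex0 0)) => v.
  by rewrite vertex_map0; congr f; apply/ffunP => - [].
have [m] := ubnP #|~: S|; elim: m => // m IHm in S f * => cardS fC.
have [S1|[c cS]] : S = setT \/ exists c, c \notin S.
  have [->|] := eqVneq S setT; first by left.
  by rewrite -subTset => /subsetPn[c _ cS]; right; exists c.
  have [|g gC gE] := @corner_completion X n f hX fX.
    by move=> a; apply: fC; rewrite S1.
  exists g => // x a _ xa; apply: gE; apply: contraFneq xa => ->.
  by rewrite ffunE.
have [a|g gC gE] := IHn [set l | lift c l \in S] (f \o insert0 c).
  rewrite inE => /fC fa.
  apply: cubical_eq (cubical_comp (affine_insert0 c) fa) => v /=; congr f.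
  apply/ffunP => k; rewrite !ffunE.
  case: unliftP => [l ->|->]; last by rewrite (negPf (neq_lift _ _)).
  by rewrite (inj_eq lift_inj) ffunE.
pose F (x : cube _) := if x c then f x else g (drop_coord c x).
have FE (x : cube n.+1) a : a \in S -> x a = false -> F x = f x.
  move=> aS xa; rewrite /F; case xc: (x c) => //.
  have [l al] : exists l, a = lift c l.
    case: (unliftP c a) => [l ->|ac]; first by exists l.
    by rewrite ac (negPf cS) in aS.
  rewrite (gE _ l) ?inE -?al //= ?drop_coordK ?fix_coord_id //.
  by rewrite ffunE -al.
have [||h hC hE] := IHm (c |: S) F.
- rewrite -ltnS; apply: leq_trans cardS; rewrite ltnS.
  apply: proper_card; rewrite properE setCS subsetUr /=.
  by apply/subsetPn; exists c; rewrite !inE ?cS ?eqxx.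
- move=> a /setU1P[->|aS].
    apply: cubical_eq (cubical_comp (affine_drop c) gC) => v /=.
    rewrite /F ffunE eqxx; congr g; apply/ffunP => l.
    by rewrite !ffunE eq_sym (negPf (neq_lift _ _)).
  by apply: cubical_eq (fC a aS) => v; rewrite /= (FE _ a) // ffunE eqxx.
exists h => // x a aS xa; rewrite (hE x a) ?(FE x a) //.
by rewrite !inE aS orbT.
Qed.

(** Write f(s,t) for the restriction of f to x_a = s, x_b = t.  The hypotheses
    say that [f(0,0), f(0,1)] and [f(0,0), f(1,1)] are cubes, the conclusion
    that [f(0,1), f(1,1)] is one.  Take F with F(0,t) = f(0,t) and
    F(s,0) = f(s,s), fill it, and restrict the filler to the antidiagonal
    t = 1 - s, where it takes the values f(0,1) and f(1,1). *)
Lemma face_gluing (X : cubeset) (n : nat) (a b : 'I_n) (f : cube n -> X 0%N) :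
  concrete X -> fibrant X -> a != b ->
  cubical (f \o fix_coord a false) -> cubical (f \o copy_coord a b) ->
  cubical (f \o fix_coord b true).
Proof.
move=> hX fX ab f0 fab.
pose F (x : cube _) := if x a then f (copy_coord b a x) else f x.
have [c|g gC gE] := @corner_filling X n [set a; b] F hX fX.
  rewrite !inE => /orP[] /eqP ->.
    by apply: cubical_eq f0 => v; rewrite /= /F ffunE eqxx.
  (* On x_b = 0 the value of F is f(s,s) with s = x_a, and swp brings this s to
     the coordinate b, from which copy_coord a b reads it. *)
  pose swp (x : cube n) := [ffun k => x (if k == b then a else k)].
  have swpA : is_affine swp.
    apply: affine_coord => k.
    exists (Some (if k == b then a else k)), false => x.
    by rewrite ffunE addbF.
  apply: cubical_eq (cubical_comp swpA fab) => v /=.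
  rewrite /F !ffunE (negPf ab); case va: (v a); congr f; apply/ffunP => k;
    rewrite !ffunE ?eqxx ?(negPf ab); case: (k =P b) => [->|_];
    rewrite ?eqxx ?(eq_sym b) ?(negPf ab) ?va //;
    by case: (k =P a) => [->|]; rewrite ?va.
pose anti (x : cube n) := [ffun k => if k == b then ~~ x a else x k].
have antiA : is_affine anti.
  apply: affine_coord => k.
  exists (Some (if k == b then a else k)), (k == b) => x.
  by rewrite ffunE /=; case: (k == b); rewrite ?addbT ?addbF.
apply: cubical_eq (cubical_comp antiA gC) => v /=.
have antiE : anti v a = v a by rewrite ffunE (negPf ab).
rewrite (gE _ (if v a then b else a)); first last.
- by case va: (v a); rewrite ?antiE // ffunE eqxx va.
- by case: (v a); rewrite !inE eqxx ?orbT.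
rewrite /F antiE; case va: (v a); congr f; apply/ffunP => k; rewrite !ffunE.
  by case: (k =P b) => // _; rewrite ?(negPf ab).
by case: (k =P b) => // _; rewrite va.
Qed.

(** Completion at an arbitrary vertex: the reflection r exchanges w with 1...1
    and the faces x_a = 1 - w_a with the faces x_a = 0. *)
Lemma corner_completion_at (X : cubeset) (n : nat) (w : cube n.+1)
    (f : cube n.+1 -> X 0%N) :
  concrete X -> fibrant X ->
  (forall a, cubical (f \o fix_coord a (~~ w a))) ->
  exists2 g, cubical g & forall x, x != w -> g x = f x.
Proof.
move=> hX fX fC.
pose r (x : cube n.+1) : cube n.+1 := [ffun k => x k (+) ~~ w k].
have rA : is_affine r.
  by apply: affine_coord => k; exists (Some k), (~~ w k) => x; rewrite ffunE.
have rK : involutive r by move=> x; apply/ffunP => k; rewrite !ffunE addbK.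
have r1 : r (vertex1 n.+1) = w by apply/ffunP => k; rewrite !ffunE addTb negbK.
have [a|g gC gE] := @corner_completion X n (f \o r) hX fX.
  apply: cubical_eq (cubical_comp rA (fC a)) => v /=; congr f.
  by apply/ffunP => k; rewrite !ffunE; case: eqP => // ->.
exists (g \o r); first exact: cubical_comp.
move=> x xw; rewrite /= gE /= ?rK //.
by apply: contraNneq xw => rx; rewrite -r1 -rx rK.
Qed.

(** * The corners of Gamma *)

(** A linear p that only rewrites coordinate a, without reading it, factors as
    s \o drop_coord a with s injective; its image consists of its fixed points,
    so it misses w as soon as p moves w.  The two instances needed are the
    projections onto x_a = 0 and onto x_a = x_b. *)
Lemma linear_projection_corner (n : nat) (a : 'I_n.+1) (w : cube n.+1)
    (p : gamma_hom n.+1 n.+1) :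
  p \o fix_coord a false =1 p -> (forall x k, k != a -> p x k = x k) ->
  p w a != w a -> gamma_corner w n.+1 p.
Proof.
move=> pa pk pw.
have dL : is_linear (drop_coord a).
  by apply: affine_linear (affine_drop a) _; apply/ffunP => k; rewrite !ffunE.
pose s := GammaHom (is_linear_comp (gamma_linear p) (is_linear_insert0 a)).
have sK : cancel s (drop_coord a).
  move=> x; apply/ffunP => l; rewrite ffunE /= pk 1?eq_sym ?neq_lift //.
  by rewrite ffunE liftK.
have pE x : p x = s (drop_coord a x) by rewrite /= drop_coordK -[LHS]pa.
exists s; last by exists (GammaHom dL); apply: gamma_hom_eq.
split; first exact: can_inj sK.
apply: contraNN pw => /codomP[y wy].
by rewrite pE {1}wy sK -wy.
Qed.

Lemma linear_fix0 (n : nat) (a : 'I_n) : is_linear (fix_coord a false).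
Proof.
by apply: affine_linear (affine_fix a false) _; rewrite fix_coord_id ?ffunE.
Qed.

Lemma linear_copy (n : nat) (a b : 'I_n) : is_linear (copy_coord a b).
Proof.
apply: affine_linear (affine_copy a b) _.
by apply/ffunP => k; rewrite !ffunE if_same.
Qed.

Lemma fix0_in_corner (n : nat) (a : 'I_n.+1) (w : cube n.+1) :
  w a -> gamma_corner w n.+1 (GammaHom (linear_fix0 a)).
Proof.
move=> wa; apply: (@linear_projection_corner _ a) => [x|x k /negPf ka|] /=.
- by rewrite [LHS]fix_coord_id // ffunE eqxx.
- by rewrite ffunE ka.
- by rewrite ffunE eqxx wa.
Qed.

Lemma copy_in_corner (n : nat) (a b : 'I_n.+1) (w : cube n.+1) :
  w a != w b -> gamma_corner w n.+1 (GammaHom (linear_copy a b)).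
Proof.
move=> wab; have ba : b != a by apply: contraNneq wab => ->.
apply: (@linear_projection_corner _ a) => [x|x k /negPf ka|] /=.
- by apply/ffunP => k; rewrite !ffunE (negPf ba); case: (k == a).
- by rewrite ffunE ka.
- by rewrite ffunE eqxx eq_sym.
Qed.

Lemma gamma_corner_avoids (n k : nat) (w : cube n.+1) (q : gamma_hom k n.+1)
    (x : cube k) :
  gamma_corner w k q -> q x != w.
Proof.
case=> s [_ ws] [t <-]; apply: contraNneq ws => <-; exact: codom_f.
Qed.

(** A linear map that misses 1...1 has a coordinate that vanishes at 1...1, hence
    everywhere, and so factors through a face x_a = 0. *)
Lemma gamma_corner_sub_box (n k : nat) (q : gamma_hom k n.+1) :
  gamma_corner (vertex1 n.+1) k q -> box_corner n k (fun_hom Gamma_to_Box q).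
Proof.
case=> s [_ s1] [t <-].
have [a sa] : exists a, s (vertex1 n) a = false.
  by apply: neq_vertex1; apply: contraNneq s1 => <-; exact: codom_f.
exists a => //.
exists (BoxHom (is_affine_comp (affine_drop a) (is_affine_comp
   (is_linear_affine (gamma_linear s)) (is_linear_affine (gamma_linear t))))).
apply: box_hom_eq => v /=; rewrite drop_coordK fix_coord_id //.
exact: linear_coord_le (gamma_linear s) sa _.
Qed.

(** The only vertex of a cube that is a morphism of Gamma is the origin; a
    general vertex x is recorded in Gamma by the edge from the origin to x. *)
Definition ray (k : nat) (x : cube k) (t : cube 1) : cube k :=
  [ffun i => x i && t ord0].

Lemma linear_ray (k : nat) (x : cube k) : is_linear (ray x).
Proof.
apply: affine_linear; last by apply/ffunP => i; rewrite !ffunE andbF.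
apply: affine_coord => i; case xi: (x i).
  by exists (Some ord0), false => t; rewrite ffunE xi addbF.
by exists None, false => t; rewrite ffunE xi.
Qed.

Lemma ray_vertex1 (k : nat) (x : cube k) : ray x (vertex1 1) = x.
Proof. by apply/ffunP => i; rewrite !ffunE andbT. Qed.

Lemma linear_ray_comp (m n : nat) (f : cube m -> cube n) (x : cube m) :
  is_linear f -> f \o ray x =1 ray (f x).
Proof.
move=> fL t /=.
have [->|] := eqVneq t (vertex1 1); first by rewrite !ray_vertex1.
move=> /neq_vertex1[i]; rewrite (ord1 i) => t0.
have ray0 k (y : cube k) : ray y t = vertex0 k.
  by apply/ffunP => l; rewrite !ffunE t0 andbF.
by rewrite !ray0 linear_vertex0.
Qed.

(** The value at x of the cube attached to q is the endpoint of the cube attached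
    to q \o ray x = ray (q x), which depends on the vertex q x only. *)
Lemma gamma_corner_values (X : cubeset) (n : nat) (w : cube n.+1)
    (u : nattrans (sub_val (gamma_corner w)) (restriction Gamma_to_Box X)) :
  w != vertex0 n.+1 ->
  exists f : cube n.+1 -> X 0%N,
    forall k (q : sub_val (gamma_corner w) k),
      @vertex_map X k (u k q) =1 f \o (proj1_sig q : gamma_hom k n.+1).
Proof.
move=> w0.
have uray k (q : sub_val (gamma_corner w) k) x :
    @vertex_map X k (u k q) x =
    @vertex_map X 1 (u 1%N (@res Gamma _ 1%N k (GammaHom (linear_ray x)) q))
      (vertex1 1).
  by rewrite nt_natural vertex_map_res /= ray_vertex1.
have uE k (q : sub_val (gamma_corner w) k) x
    k' (q' : sub_val (gamma_corner w) k') x' :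
    (proj1_sig q : gamma_hom k n.+1) x =
      (proj1_sig q' : gamma_hom k' n.+1) x' ->
    @vertex_map X k (u k q) x = @vertex_map X k' (u k' q') x'.
  move=> qq; rewrite [LHS]uray [RHS]uray; congr (vertex_map (u _ _) _).
  apply: eq_exist; apply: gamma_hom_eq => t /=.
  have := linear_ray_comp x (gamma_linear (proj1_sig q)) t.
  have := linear_ray_comp x' (gamma_linear (proj1_sig q')) t.
  by move=> /= -> ->; rewrite qq.
have [v|f fP] := @choice _ _ (fun v p => forall k
    (q : sub_val (gamma_corner w) k) x,
    (proj1_sig q : gamma_hom k n.+1) x = v -> @vertex_map X k (u k q) x = p);
  last by exists f => k q x; apply: fP.
have [[k [q [x <-]]]|qv] := pselect (exists k
    (q : sub_val (gamma_corner w) k) x,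
    (proj1_sig q : gamma_hom k n.+1) x = v).
  by exists (@vertex_map X k (u k q) x) => k' q' x'; apply: uE.
have [a wa] := neq_vertex0 w0.
(* No morphism of the corner reaches v: any value will do, for example that at
   the origin. *)
exists (@vertex_map X n.+1 (u n.+1 (exist _ _ (fix0_in_corner wa)))
          (vertex0 n.+1)).
by move=> k q x qx; case: qv; exists k, q, x.
Qed.

(** * The two implications *)

(** The vertex values of a map on the corner at w form a function whose
    pullbacks along the projections onto the hyperplanes x_a = 0 (w_a = 1) and
    x_a = x_b (w_a <> w_b) are cubical.  Gluing gives the faces x_b = 1 for
    w_b = 0, so all the faces that miss w are cubical, and completion at w
    yields the extension. *)
Lemma fibrant_gamma_rlp (X : cubeset) :
  concrete X -> fibrant X ->
  has_rlp_against (to_terminal (restriction Gamma_to_Box X)) Lambda_Gamma.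
Proof.
move=> hX fX A B i.
case=> n w w0 u v _.
have [f fE] := gamma_corner_values u w0.
have f0 a : w a -> cubical (f \o fix_coord a false).
  by move=> wa; exists (u n.+1 (exist _ _ (fix0_in_corner wa))); apply: fE.
have [a wa] := neq_vertex0 w0.
have f1 b : w b = false -> cubical (f \o fix_coord b true).
  move=> wb; have wab : w a != w b by rewrite wa wb.
  have ab : a != b by apply: contraNneq wab => ->.
  apply: (face_gluing hX fX ab (f0 a wa)).
  by exists (u n.+1 (exist _ _ (copy_in_corner wab))); apply: fE.
have [b|g [y yg] gE] := @corner_completion_at X n w f hX fX.
  by case wb: (w b); [apply: f0 | apply: f1].
pose h (k : obj Gamma) (q : yoneda (C := Gamma) n.+1 k) :
  restriction Gamma_to_Box X k := res (fun_hom Gamma_to_Box q) y.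
have hN (k l : obj Gamma) (t : Defs.hom k l) (q : yoneda (C := Gamma) n.+1 l) :
    h k (res t q) = res t (h l q).
  by rewrite /h /= -res_comp; congr (res _ y); apply: box_hom_eq.
exists (NatTrans hN); split=> [k q|k q]; last by case: (v k q).
apply: concrete_eq => // x; rewrite [RHS]fE vertex_map_res /= yg gE //.
exact: gamma_corner_avoids (proj2_sig q).
Qed.

(** The cubical corner restricted to Gamma contains the Gamma-corner at the
    vertex 1...1.  An extension over the Gamma-corner is, by the Yoneda lemma,
    an element of X(n+1), that is, a map from the whole cube; it agrees with the
    given map on the faces x_a = 0 because these are themselves linear, hence
    belong to the Gamma-corner, and they generate the cubical corner. *)
Lemma gamma_rlp_fibrant (X : cubeset) :
  has_rlp_against (to_terminal (restriction Gamma_to_Box X)) Lambda_Gamma ->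
  fibrant X.
Proof.
move=> rX n u.
have v1 : vertex1 n.+1 != vertex0 n.+1.
  by apply/eqP => /ffunP/(_ ord0); rewrite !ffunE.
pose u' (k : obj Gamma) (q : sub_val (gamma_corner (vertex1 n.+1)) k) :
  restriction Gamma_to_Box X k :=
  u k (exist _ _ (gamma_corner_sub_box (proj2_sig q))).
have uN (k l : obj Gamma) (t : Defs.hom k l)
    (q : sub_val (gamma_corner (vertex1 n.+1)) l) :
    u' k (res t q) = res t (u' l q).
  rewrite /u' /= -nt_natural; congr (u k _); apply: eq_exist.
  exact: box_hom_eq.
have [h [hE _]] := rX _ _ _ (Lambda_Gamma_corner v1) (NatTrans uN)
  (to_terminal _) (fun _ _ => erefl).
pose y : X n.+1 := h n.+1 (@idm Gamma n.+1).
pose g (k : obj Box) (q : yoneda (C := Box) n.+1 k) : X k := res q y.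
have gN (k l : obj Box) (t : Defs.hom k l) (q : yoneda (C := Box) n.+1 l) :
    g k (res t q) = res t (g l q) by exact: res_comp.
exists (NatTrans gN) => k [q qC] /=.
have [a _ [s sq]] := qC.
pose d : gamma_hom n n.+1 := GammaHom (is_linear_insert0 a).
have dC : gamma_corner (vertex1 n.+1) n d.
  exists d; last by exists (@idm Gamma n); apply: gamma_hom_eq.
  split; first exact: can_inj (insert0K a).
  apply/codomP => - [x /ffunP/(_ a)]; rewrite !ffunE.
  by rewrite unlift_none.
have dy : @res Box X n n.+1 (face a) y = u' n (exist _ _ dC).
  have := hE n (exist _ _ dC) => /= <-.
  have -> : @res Box X n n.+1 (face a) y =
      h n (@res Gamma (yoneda (C := Gamma) n.+1) n n.+1 d (@idm Gamma n.+1)).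
    by rewrite nt_natural; congr (res _ y); apply: box_hom_eq.
  by congr (h n _); apply: gamma_hom_eq.
have -> : g k q = @res Box X k n s (@res Box X n n.+1 (face a) y).
  by rewrite -res_comp /g -sq.
rewrite dy /u' -nt_natural; congr (u k _); apply: eq_exist.
by rewrite -sq; apply: box_hom_eq.
Qed.

Theorem mainTheorem7 (X : cubeset) (hX : concrete X) :
  fibrant X <->
  has_rlp_against (to_terminal (restriction Gamma_to_Box X)) Lambda_Gamma.
Proof. by split; [apply: fibrant_gamma_rlp | apply: gamma_rlp_fibrant]. Qed.
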